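(* Let $G$ be a finite group, let $C_G$ be the cyclic group of order $|G|$, let $w\colon A(C_G)\to A(G)$ be the Frobenius--Wielandt map, and let $w_n\colon A(C_G\wr\Sigma_n)\to A(G\wr\Sigma_n)$ be the composite \[w_n\colon A(C_G\wr\Sigma_n)\xrightarrow{\ r\ }\mathring{A}(C_G,n)\xrightarrow{\ \mathring{w}\ }\mathring{A}(G,n)\hookrightarrow A(G\wr\Sigma_n).\] Then there is a commutative diagram \[\begin{array}{ccc}A(C_G)&\xrightarrow{\ w\ }&A(G)\\ {\scriptstyle\mathbb{P}_n}\downarrow&&\downarrow{\scriptstyle\mathbb{P}_n}\\ A(C_G\wr\Sigma_n)&\xrightarrow{\ w_n\ }&A(G\wr\Sigma_n).\end{array}\]
   Context: For a finite group $\Gamma$, $A(\Gamma)$ is the Burnside ring, with canonical $\mathbb{Z}$-basis the isomorphism classes of transitive $\Gamma$-sets; $\mathrm{Conj}(\Gamma)$ is the set of conjugacy classes of subgroups; the marks homomorphism $\chi\colon A(\Gamma)\to\mathrm{Marks}(\Gamma)=\mathrm{Fun}(\mathrm{Conj}(\Gamma),\mathbb{Z})$, $\chi([X])([K])=|X^K|$, is injective. The Frobenius--Wielandt map $w\colon A(C_G)\to A(G)$ is the ring homomorphism characterized by $\chi(w(x))([K])=\chi(x)([C_K])$, where $C_K\subseteq C_G$ is the unique subgroup of order $|K|$ (its existence is a known theorem of Dress--Siebeneicher--Yoshida). $\Gamma\wr\Sigma_n=\Gamma^{\times n}\rtimes\Sigma_n$ with $(\bar g,\sigma)(\bar h,\tau)=(\bar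 g\,\sigma\bar h,\sigma\tau)$, $(\sigma\bar h)_i=\bar h_{\sigma^{-1}(i)}$; for a left $\Gamma$-set $X$ it acts on $X^{\times n}$ by $((\bar g,\sigma)x)_i=\bar g_ix_{\sigma^{-1}(i)}$. The transfer product $\star\colon A(\Gamma\wr\Sigma_i)\otimes A(\Gamma\wr\Sigma_j)\to A(\Gamma\wr\Sigma_{i+j})$ is $X\star Y=(\Gamma\wr\Sigma_{i+j})\times_{\Gamma\wr\Sigma_i\times\Gamma\wr\Sigma_j}(X\times Y)$. The total power operations $\mathbb{P}_n\colon A(\Gamma)\to A(\Gamma\wr\Sigma_n)$ are the unique functions with $\mathbb{P}_n([X])=[X^{\times n}]$, $\mathbb{P}_0=1$, $\mathbb{P}_n(x+y)=\sum_{i+j=n}\mathbb{P}_i(x)\star\mathbb{P}_j(y)$. $\mathring{A}(\Gamma,n)\subseteq A(\Gamma\wr\Sigma_n)$ is the summand spanned by the smallest subset of the canonical basis whose span contains the image of $\mathbb{P}_n$; $\mathring{A}(\Gamma)=\bigoplus_{n\ge0}\mathring{A}(\Gamma,n)$ is a commutative graded ring under $\star$, polynomial on the generators $\mathbb{P}_n([\Gamma/K])$, $n>0$, $[K]\in\mathrm{Conj}(\Gamma)$. $\mathring{w}\colon\mathring{A}(C_G)\to\mathring{A}(G)$ is the unique graded ring homomorphism (for $\star$) with $\mathring{w}(\mathbb{P}_n(x))=\mathbb{P}_n(w(x))$ for all $x\in A(C_G)$, $n\ge0$. For a subgroup $H\subseteq\Gamma\wr\Sigma_n$, let $H$ act on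 $[n]=\{1,\dots,n\}$ through $\Gamma\wr\Sigma_n\to\Sigma_n$, let $H\backslash[n]$ be its set of orbits $Hi$, and let $H_{ii}=\{\bar g_i\mid(\bar g,\sigma)\in H,\ \sigma(i)=i\}\subseteq\Gamma$. The map $r\colon A(\Gamma\wr\Sigma_n)\to\mathring{A}(\Gamma,n)$ is the additive map given on the canonical basis by \[r([(\Gamma\wr\Sigma_n)/H])=\bigstar_{Hi\in H\backslash[n]}\mathbb{P}_{|Hi|}([\Gamma/H_{ii}]),\] the $\star$-product over the orbits of $H$ on $[n]$ (independent of the chosen orbit representatives $i$ and of $H$ within its conjugacy class). In the claim $r$ is taken with $\Gamma=C_G$. *)

(* Defs.v *)
From HB Require Import structures.
From mathcomp Require Import all_boot all_order all_algebra all_fingroup.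

Set Implicit Arguments.
Unset Strict Implicit.
Unset Printing Implicit Defensive.

Import GRing.Theory.
Import GroupScope.

(** * Finite Γ-sets *)

(* MathComp actions are right actions. A left Γ-set is encoded by the right
   action [x . g := g^-1 x]; [lact] is the left action it stands for. Orbits,
   stabilizers and fixed points do not depend on the side. *)
Record gset (gT : finGroupType) := GSet {
  gset_sort :> finType;
  gset_act : {action gT &-> gset_sort}
}.

Definition lact (gT : finGroupType) (X : gset gT) (g : gT) (x : X) : X :=
  gset_act X x g^-1.

Section LeftAction.
Variables (gT : finGroupType) (X : finType) (f : gT -> X -> X).
Hypotheses (f1 : forall x, f 1 x = x)
           (fM : forall g h x, f (g * h) x = f g (f h x)).

Definition left_to (x : X) (g : gT) : X := f g^-1 x.

Fact left_to1 : left_to^~ 1 =1 id.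
Proof. by move=> x; rewrite /left_to invg1 f1. Qed.

Fact left_toM : forall x, act_morph left_to x.
Proof. by move=> x g h; rewrite /left_to invMg fM. Qed.

Definition left_gset : gset gT := GSet (TotalAction left_to1 left_toM).

Lemma left_gsetE g x : @lact gT left_gset g x = f g x.
Proof. by rewrite /lact /= /left_to invgK. Qed.
End LeftAction.

Section LactTheory.
Variables (gT : finGroupType) (X : gset gT).

Lemma lact1 (x : X) : lact 1 x = x.
Proof. by rewrite /lact invg1 act1. Qed.

Lemma lactM g h (x : X) : lact (g * h) x = lact g (lact h x).
Proof. by rewrite /lact invMg actM. Qed.
End LactTheory.

Section BasicGSets.
Variable gT : finGroupType.

Definition point_gset : gset gT :=
  @left_gset gT unit (fun _ x => x) (fun=> erefl) (fun _ _ => fun=> erefl).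

Section Product.
Variables X Y : gset gT.
Let f (g : gT) (p : X * Y) := (lact g p.1, lact g p.2).
Fact prod_gset1 p : f 1 p = p.
Proof. by rewrite /f !lact1 -surjective_pairing. Qed.
Fact prod_gsetM g h p : f (g * h) p = f g (f h p).
Proof. by rewrite /f !lactM. Qed.
Definition prod_gset : gset gT := left_gset prod_gset1 prod_gsetM.
End Product.

Section Coset.
Variable H : {group gT}.

Definition coset_sort : predArgType :=
  {A : {set gT} | A \in lcosets H [set: gT]}.

Fact coset_gset_subproof g (A : coset_sort) :
  g *: val A \in lcosets H [set: gT].
Proof.
case/lcosetsP: (valP A) => x _ ->.
by rewrite -lcosetM; apply/lcosetsP; exists (g * x); rewrite ?inE.
Qed.

Let f (g : gT) (A : coset_sort) : coset_sort :=
  exist _ (g *: val A) (coset_gset_subproof g A).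

Fact coset_gset1 A : f 1 A = A.
Proof. by apply: val_inj; rewrite /= lcoset1. Qed.
Fact coset_gsetM g h A : f (g * h) A = f g (f h A).
Proof. by apply: val_inj; rewrite /= lcosetM. Qed.

(* Γ/H *)
Definition coset_gset : gset gT := left_gset coset_gset1 coset_gsetM.
End Coset.

End BasicGSets.

Section ExternalProduct.
Variables (gT1 gT2 : finGroupType) (X : gset gT1) (Y : gset gT2).
Let f (g : gT1 * gT2) (p : X * Y) := (lact g.1 p.1, lact g.2 p.2).
Fact extprod_gset1 p : f 1 p = p.
Proof. by rewrite /f /= !lact1 -surjective_pairing. Qed.
Fact extprod_gsetM g h p : f (g * h) p = f g (f h p).
Proof. by rewrite /f /= !lactM. Qed.
Definition extprod_gset : gset (gT1 * gT2)%type :=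
  left_gset extprod_gset1 extprod_gsetM.
End ExternalProduct.

(* W ×_H X for a homomorphism f : H -> W: the quotient of W × X by
   (w f(h), x) ~ (w, h x), with W acting by left multiplication on W. *)
Section Induction.
Variables (hT wT : finGroupType) (f : {morphism [set: hT] >-> wT}).
Variable X : gset hT.

Definition ind_to (p : wT * X) (h : hT) : wT * X :=
  (p.1 * f h, lact h^-1 p.2).

Fact ind_to1 : ind_to^~ 1 =1 id.
Proof. by case=> w x; rewrite /ind_to morph1 mulg1 invg1 lact1. Qed.

Fact ind_toM : forall p, act_morph ind_to p.
Proof.
by case=> w x g h; rewrite /ind_to /= morphM ?inE // mulgA invMg lactM.
Qed.

Definition ind_action := TotalAction ind_to1 ind_toM.

Definition ind_sort : predArgType :=
  {O : {set wT * X} | O \in orbit ind_action setT @: setT}.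

Let tr (u : wT) (p : wT * X) := (u * p.1, p.2).

Fact ind_gset_subproof u (O : ind_sort) :
  tr u @: val O \in orbit ind_action setT @: setT.
Proof.
case/imsetP: (valP O) => p _ ->; apply/imsetP; exists (tr u p) => //.
apply/setP=> q; apply/imsetP/orbitP => [[_ /orbitP[h _ <-] ->]|[h _ <-]].
  by exists h; rewrite // /tr /= /ind_to /= mulgA.
exists (ind_to p h); first by apply: mem_orbit; rewrite inE.
by rewrite /tr /= /ind_to /= mulgA.
Qed.

Let g (u : wT) (O : ind_sort) : ind_sort :=
  exist _ (tr u @: val O) (ind_gset_subproof u O).

Fact ind_gset1 O : g 1 O = O.
Proof.
apply: val_inj => /=; rewrite -[RHS]imset_id; apply: eq_imset => -[w x].
by rewrite /tr mul1g.
Qed.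

Fact ind_gsetM u v O : g (u * v) O = g u (g v O).
Proof.
apply: val_inj => /=; rewrite -imset_comp; apply: eq_imset => -[w x].
by rewrite /tr /= mulgA.
Qed.

Definition ind_gset : gset wT := left_gset ind_gset1 ind_gsetM.
End Induction.

(** * The Burnside ring *)

Section Conj.
Variable gT : finGroupType.

(* Conj(Γ) *)
Definition conj_sort : predArgType :=
  {c : {set {group gT}} | c \in orbit 'JG [set: gT] @: [set: {group gT}]}.

Fact conj_class_subproof (H : {group gT}) :
  orbit 'JG%act [set: gT] H \in orbit 'JG [set: gT] @: [set: {group gT}].
Proof. by apply: imset_f; rewrite inE. Qed.

Definition conj_class (H : {group gT}) : conj_sort :=
  exist _ (orbit 'JG%act [set: gT] H) (conj_class_subproof H).

Fact conj_repr_subproof (c : conj_sort) : exists H, H \in val c.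
Proof. by case/imsetP: (valP c) => H _ ->; exists H; apply: orbit_refl. Qed.

Definition conj_repr (c : conj_sort) : {group gT} :=
  xchoose (conj_repr_subproof c).

Lemma conj_reprK : cancel conj_repr conj_class.
Proof.
move=> c; apply: val_inj; rewrite [LHS]/=.
have := xchooseP (conj_repr_subproof c); rewrite -/(conj_repr c).
by case/imsetP: (valP c) => H _ -> /orbit_eqP.
Qed.

Lemma conj_classP (H K : {group gT}) :
  reflect (exists g, H :=: K :^ g) (conj_class H == conj_class K).
Proof.
apply: (iffP eqP) => [/(congr1 val)/= E|[g E]].
  have: H \in orbit 'JG%act [set: gT] K by rewrite -E orbit_refl.
  by case/orbitP=> g _ <-; exists g.
apply: val_inj; apply/orbit_eqP/orbitP; exists g; rewrite ?inE //.
exact/val_inj/esym.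
Qed.

End Conj.

(* A(Γ), by coordinates in the canonical basis: [Γ/H] is the basis element
   indexed by the conjugacy class of H. *)
Definition burnside (gT : finGroupType) := {ffun conj_sort gT -> int}.
HB.instance Definition _ gT := GRing.Zmodule.on (burnside gT).

Section Burnside.
Variable gT : finGroupType.
Local Notation A := (burnside gT).
Implicit Types (X Y : gset gT) (H K : {group gT}) (c d : conj_sort gT).
Implicit Types x y z : A.

(* [X]: the coordinate at c is the number of orbits isomorphic to Γ/H, H in c *)
Definition gset_class X : A :=
  [ffun c => Posz #|[set O in orbit (gset_act X) setT @: setT |
     [exists x in O, conj_class 'C[x | gset_act X]%G == c]]|].

Definition gfix X H : nat := #|'Fix_(gset_act X)(H)|.

Definition marks x : {ffun conj_sort gT -> int} :=
  [ffun d => \sum_c x c * (gfix (coset_gset (conj_repr c)) (conj_repr d))%:Z]%R.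

Definition burnside_one : A := gset_class (point_gset gT).

Definition burnside_mul x y : A :=
  (\sum_c \sum_d
    gset_class (prod_gset (coset_gset (conj_repr c)) (coset_gset (conj_repr d)))
      *~ (x c * y d))%R.

End Burnside.

Section BurnsideTheory.
Variable gT : finGroupType.
Local Notation A := (burnside gT).
Implicit Types (X Y : gset gT) (H K : {group gT}) (c d : conj_sort gT).
Implicit Types x y z : A.

Lemma gfix_orbit X K (p : X) :
  (#|'Fix_(gset_act X)(K) :&: orbit (gset_act X) setT p|
     * #|'C[p | gset_act X]|)%N
  = #|[set g | K \subset 'C[p | gset_act X] :^ g]|.
Proof.
set to := gset_act X; set S := [set g | _].
rewrite -sum_nat_const -[RHS]sum1_card (partition_big (to p)
   (mem ('Fix_to(K) :&: orbit to setT p))) /=; last first.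
  move=> g; rewrite inE -astab1_act sub_astab1 in_setI => -> /=.
  by rewrite mem_orbit ?inE.
apply: eq_bigr => q /setIP[qK /orbitP[g _ gpq]].
rewrite sum1_card -(card_rcoset _ g); apply: eq_card => h.
rewrite mem_rcoset [RHS]unfold_in [h \in S]inE -astab1_act sub_astab1.
apply/astab1P/andP => [|[_ /eqP E]]; last by rewrite actM E -gpq actK.
rewrite actM => E; have -> : to p h = q by rewrite -gpq -{2}E actKV.
by rewrite eqxx.
Qed.

Lemma gfix_cosetE H K :
  (gfix (coset_gset H) K * #|H|)%N = #|[set g | K \subset H :^ g]|.
Proof.
have p0 : (H : {set gT}) \in lcosets H [set: gT].
  by apply/lcosetsP; exists 1; rewrite ?inE // lcoset1.
pose p : coset_gset H := exist _ (H : {set gT}) p0.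
have E : 'C[p | gset_act (coset_gset H)] = H.
  apply/setP=> g; apply/astab1P/idP => [/(congr1 val)/= E|Hg].
    rewrite -groupV -E; have := mem_lcoset H g^-1 g^-1.
    by rewrite invgK mulgV group1 => ->.
  by apply: val_inj; rewrite /= lcoset_id ?groupV.
rewrite -[in RHS]E -gfix_orbit E; congr (_ * _)%N; apply: eq_card => q.
rewrite in_setI andb_idr // => _; apply/orbitP.
case/lcosetsP: (valP q) => g _ qE; exists g^-1; rewrite ?inE //.
by apply: val_inj; rewrite /= invgK -qE.
Qed.

Lemma gfix_coset_conj H H' K K' g h : H :=: H' :^ g -> K :=: K' :^ h ->
  gfix (coset_gset H) K = gfix (coset_gset H') K'.
Proof.
move=> EH EK; apply/eqP; rewrite -(eqn_pmul2r (cardG_gt0 H)) gfix_cosetE.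
have -> : #|H| = #|H'| by rewrite EH cardJg.
rewrite gfix_cosetE; apply/eqP.
rewrite -[LHS](card_lcoset _ g) -[LHS](card_rcoset _ h^-1).
apply: eq_card => u; rewrite mem_rcoset mem_lcoset !inE EH EK !invgK.
by rewrite -conjsgM mulKVg conjsgM conjSg.
Qed.

Lemma gfix_repr H K : 
  gfix (coset_gset (conj_repr (conj_class H))) (conj_repr (conj_class K))
  = gfix (coset_gset H) K.
Proof.
have /eqP/conj_classP[g Eg] := conj_reprK (conj_class H).
have /eqP/conj_classP[h Eh] := conj_reprK (conj_class K).
exact: gfix_coset_conj Eg Eh.
Qed.

Lemma marks_classE X K : marks (gset_class X) (conj_class K) = gfix X K.
Proof.
set to := gset_act X; set OO := orbit to setT @: setT.
have st (p q : X) : q \in orbit to setT p ->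
    conj_class 'C[q | to]%G = conj_class 'C[p | to]%G.
  by case/orbitP=> g _ <-; apply/eqP/conj_classP; exists g; apply: astab1_act.
have partO : partition OO [set: X].
  by apply: orbit_partition; apply/actsP=> g _ p; rewrite !inE.
transitivity (Posz (\sum_(O in OO) #|'Fix_to(K) :&: O|)); last first.
  congr Posz; rewrite /gfix -/to.
  have -> : #|'Fix_to(K)| = \sum_(x in [set: X]) (if x \in 'Fix_to(K) then 1 else 0).
    by rewrite -sum1_card big_mkcond; apply: eq_big => // x; rewrite in_setT.
  rewrite (set_partition_big _ partO); apply: eq_bigr => O _.
  rewrite -big_mkcondr sum1_card; apply: eq_card => x.
  by rewrite in_setI andbC.
rewrite ffunE (big_morph Posz PoszD (erefl _)).
pose F c := gfix (coset_gset (conj_repr c)) (conj_repr (conj_class K)).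
pose P (O : {set X}) c := [exists x in O, conj_class 'C[x | to]%G == c].
transitivity (\sum_c \sum_(O in OO | P O c) Posz (F c))%R.
  apply: eq_bigr => c _; rewrite ffunE -/to -/OO sumr_const -mulr_natl.
  by congr (_ * _)%R; rewrite natz; congr Posz; apply: eq_card => O; rewrite inE.
rewrite (exchange_big_dep (mem OO)) /=; last by move=> c O _ /andP[].
apply: eq_bigr => _ /imsetP[p _ ->].
rewrite (big_pred1 (conj_class 'C[p | to]%G)) => [|c]; last first.
  apply/andP/eqP => [[_ /existsP[q /andP[/st-> /eqP]]] //|->].
  split; first by apply: imset_f; rewrite inE.
  by apply/existsP; exists p; rewrite orbit_refl /=.
rewrite /F gfix_repr; congr Posz; apply/eqP.
by rewrite -(eqn_pmul2r (cardG_gt0 'C[p | to]%G)) gfix_cosetE gfix_orbit.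
Qed.

Fact marks_is_additive : zmod_morphism (@marks gT).
Proof.
move=> x y; apply/ffunP=> d; rewrite !ffunE -sumrB; apply: eq_bigr => c _.
by rewrite !ffunE mulrBl.
Qed.

HB.instance Definition _ :=
  GRing.isZmodMorphism.Build A {ffun conj_sort gT -> int} (@marks gT)
    marks_is_additive.

Lemma marks_inj : injective (@marks gT).
Proof.
suff inj0 x : marks x = 0%R -> x = 0%R.
  move=> x y E; apply/eqP; rewrite -subr_eq0; apply/eqP/inj0.
  by rewrite raddfB /= E subrr.
move=> x0; apply/ffunP=> c1; rewrite [RHS]ffunE; apply/eqP/negPn/negP=> nz1.
have [c nz maxc] := @arg_maxnP _ c1 (fun c => x c != 0%R)
   (fun c => #|conj_repr c|) nz1.
have gt0 H K : (gfix (coset_gset H) K != 0%N) -> exists g, K \subset H :^ g.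
  move=> nzf; have: #|[set g | K \subset H :^ g]| != 0%N.
    by rewrite -gfix_cosetE muln_eq0 negb_or nzf -lt0n cardG_gt0.
  by rewrite cards_eq0 => /set0Pn[g]; rewrite inE; exists g.
have /eqP := congr1 (fun f : {ffun _ -> int} => f c) x0.
rewrite !ffunE (bigD1 c) //= big1 ?addr0 => [|d dc]; last first.
  apply/eqP; rewrite mulf_eq0 -[_ || _]negbK negb_or.
  apply/negP=> /andP[nzd /gt0[g sub]].
  case/eqP: dc; rewrite -[d]conj_reprK -[c]conj_reprK; apply/eqP.
  rewrite eq_sym; apply/conj_classP; exists g; apply/eqP.
  by rewrite eqEcard sub cardJg; apply: maxc.
rewrite mulf_eq0 (negPf nz) /= => /eqP[f0].
have := gfix_cosetE (conj_repr c) (conj_repr c); rewrite f0 mul0n.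
by move/esym/eqP; rewrite cards_eq0 => /eqP/setP/(_ 1); rewrite !inE conjsg1 subxx.
Qed.

Lemma gset_class_coset H :
  gset_class (coset_gset H) = [ffun c => (c == conj_class H)%:Z]%R.
Proof.
apply: marks_inj; apply/ffunP=> d; rewrite -[d]conj_reprK marks_classE ffunE.
rewrite (bigD1 (conj_class H)) //= ffunE eqxx mul1r gfix_repr big1 ?addr0 //.
by move=> c /negPf ne; rewrite ffunE ne mul0r.
Qed.

Lemma burnsideMz x n c : (x *~ n)%R c = (x c * n)%R.
Proof.
case: n => n; first by rewrite -pmulrn ffunMnE -mulrzz pmulrn.
by rewrite NegzE mulrNz mulrN -pmulrn ffunE ffunMnE -mulrzz pmulrn.
Qed.

Lemma marks_one d : marks (burnside_one gT) d = 1%R.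
Proof.
rewrite -[d]conj_reprK marks_classE /gfix; congr Posz.
rewrite (eq_card (B := [set: point_gset gT])) ?cardsT ?card_unit // => x.
by rewrite in_setT; apply/afixP=> g _; case: x.
Qed.

Lemma gfix_prod X Y K : gfix (prod_gset X Y) K = (gfix X K * gfix Y K)%N.
Proof.
rewrite /gfix -cardsX; apply: eq_card => -[p q]; rewrite in_setX.
apply/afixP/andP => [fpq|[/afixP fp /afixP fq] g Kg].
  by split; apply/afixP=> g /fpq[]; rewrite /lact invgK.
by rewrite -[LHS]/(lact g^-1 p, lact g^-1 q) /lact !invgK fp ?fq.
Qed.

Lemma marks_mul x y d : marks (burnside_mul x y) d = (marks x d * marks y d)%R.
Proof.
rewrite raddf_sum sum_ffunE [marks x d]ffunE mulr_suml; apply: eq_bigr => c _.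
rewrite raddf_sum sum_ffunE [marks y d]ffunE mulr_sumr; apply: eq_bigr => c' _.
rewrite raddfMz burnsideMz -{1}[d]conj_reprK marks_classE gfix_prod mulrACA.
by rewrite mulrC PoszM.
Qed.

Fact burnside_mulA : associative (@burnside_mul gT).
Proof.
by move=> x y z; apply/marks_inj/ffunP=> d; rewrite !marks_mul mulrA.
Qed.
Fact burnside_mulC : commutative (@burnside_mul gT).
Proof.
by move=> x y; apply/marks_inj/ffunP=> d; rewrite !marks_mul mulrC.
Qed.
Fact burnside_mul1 : left_id (burnside_one gT) (@burnside_mul gT).
Proof.
by move=> x; apply/marks_inj/ffunP=> d; rewrite marks_mul marks_one mul1r.
Qed.
Fact burnside_mulD : left_distributive (@burnside_mul gT) +%R.
Proof.
have marksD x y d : marks (x + y)%R d = (marks x d + marks y d)%R.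
  by rewrite raddfD ffunE.
move=> x y z; apply/marks_inj/ffunP=> d.
by rewrite marks_mul !marksD !marks_mul mulrDl.
Qed.
Fact burnside_one_neq0 : burnside_one gT != 0%R.
Proof.
apply/eqP=> E; have := marks_one (conj_class 1%G).
by rewrite E raddf0 ffunE => /eqP; rewrite eq_sym oner_eq0.
Qed.

HB.instance Definition _ := GRing.Zmodule_isComNzRing.Build A
  burnside_mulA burnside_mulC burnside_mul1 burnside_mulD burnside_one_neq0.

Lemma gset_classM X Y :
  gset_class (prod_gset X Y) = (gset_class X * gset_class Y)%R :> A.
Proof.
apply/marks_inj/ffunP=> d; rewrite [RHS]marks_mul -[d]conj_reprK.
by rewrite !marks_classE gfix_prod PoszM.
Qed.
End BurnsideTheory.

Lemma gfix_sum (gT : finGroupType) (X : gset gT) (K : {group gT}) :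
  Posz (gfix X K) =
  (\sum_c gset_class X c * (gfix (coset_gset (conj_repr c)) K)%:Z)%R.
Proof.
rewrite -marks_classE ffunE; apply: eq_bigr => c _.
by rewrite -(gfix_repr (conj_repr c) K) conj_reprK.
Qed.

Section IndTheory.
Variables (hT wT : finGroupType) (f : {morphism [set: hT] >-> wT}).
Hypothesis f_inj : 'injm f.
Implicit Types (X : gset hT) (K : {group wT}).

Lemma gfix_ind X K :
  (gfix (ind_gset f X) K * #|hT|)%N
  = \sum_(w | K :^ w \subset f @* setT) gfix X (f @*^-1 (K :^ w))%G.
Proof.
set to := ind_action f X.
pose S := [set p : wT * X | (K :^ p.1 \subset f @* setT)
                            && (p.2 \in 'Fix_(gset_act X)(f @*^-1 (K :^ p.1)))].
have card_orb (p : wT * X) : #|orbit to setT p| = #|hT|.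
  rewrite card_orbit; have -> : 'C_[set: hT][p | to] = 1.
    apply/trivgP/subsetP=> h /setIP[_ /astab1P/(congr1 fst)/= E]; apply/set1P.
    apply: (injmP f_inj); rewrite ?inE // morph1.
    by apply: (mulgI p.1); rewrite E mulg1.
  by rewrite indexg1 cardsT.
have valE (O : ind_sort f X) p : p \in val O -> val O = orbit to setT p.
  by case/imsetP: (valP O) => q _ -> pq; apply/esym/orbit_eqP.
have fixE (O : ind_sort f X) p : p \in val O ->
    (O \in 'Fix_(gset_act (ind_gset f X))(K)) = (p \in S).
  move=> pO; have OE := valE _ _ pO.
  have mem_tr k : (p.1 * k, p.2) \in val O ->
      exists h, f h = k /\ gset_act X p.2 h = p.2.
    rewrite OE => /orbitP[h _]; rewrite -[to p h]/(p.1 * f h, lact h^-1 p.2).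
    by case=> /mulgI fh; rewrite /lact invgK; exists h.
  apply/afixP/idP=> [fixO|].
    have conjK k : k \in K -> exists h, f h = k ^ p.1 /\ gset_act X p.2 h = p.2.
      move=> Kk; apply: mem_tr; rewrite -(fixO k^-1) ?groupV //.
      apply/imsetP; exists p => //=.
      by rewrite invgK conjgE !mulgA mulgV mul1g.
    rewrite inE; apply/andP; split.
      apply/subsetP=> _ /imsetP[k /conjK[h [fh _]] ->].
      by rewrite -fh mem_morphim ?inE.
    apply/afixP=> h /morphpreP[_]; case/imsetP=> k /conjK[h' [fh' fix' fhk]].
    suff -> : h = h' by [].
    by apply: (injmP f_inj); rewrite ?inE // fh' fhk.
  rewrite inE => /andP[sub /afixP fixp] k Kk; apply: val_inj.
  have /morphimP[h _ _ fh] : (k^-1) ^ p.1 \in f @* setT.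
    by apply: (subsetP sub); rewrite memJ_conjg groupV.
  have fixh : gset_act X p.2 h = p.2.
    by apply: fixp; rewrite !inE -fh memJ_conjg groupV.
  have p'O : (k^-1 * p.1, p.2) \in val (gset_act (ind_gset f X) O k).
    by apply/imsetP; exists p.
  rewrite (valE _ _ p'O) OE; apply/orbit_eqP/orbitP; exists h; rewrite ?inE //.
  rewrite -[LHS]/(p.1 * f h, lact h^-1 p.2) -fh /lact invgK fixh.
  by rewrite conjgE !mulgA mulgV mul1g.
have pOO p : orbit to setT p \in orbit to setT @: setT by apply: imset_f.
pose F p : ind_sort f X := exist _ (orbit to setT p) (pOO p).
transitivity #|S|.
  rewrite -sum_nat_const -[RHS]sum1_card.
  rewrite (partition_big F (mem 'Fix_(gset_act (ind_gset f X))(K))) /=.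
    apply: eq_bigr => O fixO; rewrite sum1_card.
    case/imsetP: (valP O) => p _ OE; rewrite -(card_orb p) -OE.
    apply: eq_card => q; rewrite [RHS]unfold_in.
    apply/idP/andP=> [qO|[_ /eqP<-]]; last exact: orbit_refl.
    by rewrite -(fixE _ _ qO); split=> //; apply/eqP/val_inj; rewrite (valE _ _ qO).
  by move=> p; rewrite (fixE (F p) p) ?orbit_refl.
rewrite -sum1_card (eq_bigl (fun p : wT * X => (K :^ p.1 \subset f @* setT)
   && (p.2 \in 'Fix_(gset_act X)(f @*^-1 (K :^ p.1))))) => [|p]; last by rewrite inE.
rewrite -(pair_big_dep (fun w => K :^ w \subset f @* setT)
  (fun w x => x \in 'Fix_(gset_act X)(f @*^-1 (K :^ w))) (fun _ _ => 1%N)) /=.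
by apply: eq_bigr => w _; rewrite sum1_card.
Qed.

Lemma gset_class_ind X :
  gset_class (ind_gset f X) =
  (\sum_c gset_class (ind_gset f (coset_gset (conj_repr c))) *~ gset_class X c)%R.
Proof.
apply/marks_inj/ffunP=> d; rewrite -[d]conj_reprK raddf_sum sum_ffunE.
pose K w := (conj_repr d :^ w)%G.
have nz : (#|hT|%:Z != 0)%R by rewrite -cardsT -lt0n cardG_gt0.
apply: (mulIf nz); rewrite mulr_suml marks_classE -PoszM gfix_ind.
transitivity (\sum_c \sum_(w | K w \subset f @* setT)
    gset_class X c * (gfix (coset_gset (conj_repr c)) (f @*^-1 K w)%G)%:Z)%R.
  rewrite exchange_big (big_morph Posz PoszD (erefl _)).
  apply: eq_bigr => w _ /=.
  exact: gfix_sum.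
apply: eq_bigr => c _.
rewrite raddfMz burnsideMz marks_classE mulrAC -PoszM gfix_ind mulrC.
by rewrite (big_morph Posz PoszD (erefl _)) mulr_sumr.
Qed.
End IndTheory.

Section ExtProdTheory.
Variables (gT1 gT2 : finGroupType).
Implicit Types (X : gset gT1) (Y : gset gT2).

Lemma gfix_extprod X Y (K : {group gT1 * gT2}) :
  gfix (extprod_gset X Y) K
  = (gfix X (@fst gT1 gT2 @* K)%G * gfix Y (@snd gT1 gT2 @* K)%G)%N.
Proof.
rewrite /gfix -cardsX; apply: eq_card => -[p q]; rewrite in_setX.
apply/afixP/andP => [fpq|[/afixP fp /afixP fq] g Kg].
  by split; apply/afixP=> _ /morphimP[g _ /fpq[E1 E2] ->];
     [move: E1 | move: E2]; rewrite /lact invgK.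
rewrite -[LHS]/(lact g^-1.1 p, lact g^-1.2 q) /lact !invgK.
by rewrite fp ?fq // mem_morphim ?inE.
Qed.

Lemma gset_class_extprod X Y :
  gset_class (extprod_gset X Y) =
  (\sum_c \sum_d gset_class (extprod_gset (coset_gset (conj_repr c))
                                           (coset_gset (conj_repr d)))
           *~ (gset_class X c * gset_class Y d))%R.
Proof.
apply/marks_inj/ffunP=> b; rewrite -[b]conj_reprK marks_classE gfix_extprod.
rewrite PoszM gfix_sum [X in (_ * X)%R]gfix_sum raddf_sum sum_ffunE mulr_suml.
apply: eq_bigr => c _; rewrite raddf_sum sum_ffunE mulr_sumr.
apply: eq_bigr => d _; rewrite raddfMz burnsideMz marks_classE gfix_extprod.
by rewrite PoszM mulrACA mulrC.
Qed.
End ExtProdTheory.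

(** * Wreath products *)

Section Wreath.
Variables (gT : finGroupType) (n : nat).

Record wreath := Wreath { wr_fun : {ffun 'I_n -> gT}; wr_perm : 'S_n }.

Definition wreath_pair (a : wreath) := (wr_fun a, wr_perm a).
Definition pair_wreath (p : {ffun 'I_n -> gT} * 'S_n) := Wreath p.1 p.2.
Fact wreath_pairK : cancel wreath_pair pair_wreath. Proof. by case. Qed.

HB.instance Definition _ := Finite.copy wreath (can_type wreath_pairK).

Implicit Types a b : wreath.

(* MathComp composes permutations from left to right: the permutation product
   s t of functions is [t * s] in MathComp. *)
Definition wreath_mul a b : wreath :=
  Wreath [ffun i => wr_fun a i * wr_fun b ((wr_perm a)^-1 i)]
         (wr_perm b * wr_perm a).

Definition wreath_one : wreath := Wreath [ffun => 1] 1.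

Definition wreath_inv a : wreath :=
  Wreath [ffun i => (wr_fun a (wr_perm a i))^-1] (wr_perm a)^-1.

Lemma wreathP a b :
  (forall i, wr_fun a i = wr_fun b i) ->
  (forall i, wr_perm a i = wr_perm b i) -> a = b.
Proof. by case: a b => [g s] [h t] /= /ffunP-> /permP->. Qed.

Fact wreath_mulA : associative wreath_mul.
Proof.
move=> a b c; apply: wreathP => i; last by rewrite /= mulgA.
by rewrite !ffunE mulgA invMg permM.
Qed.

Fact wreath_mul1 : left_id wreath_one wreath_mul.
Proof.
move=> a; apply: wreathP => i; last by rewrite /= mulg1.
by rewrite !ffunE mul1g invg1 perm1.
Qed.

Fact wreath_mulV : left_inverse wreath_one wreath_inv wreath_mul.
Proof.
move=> a; apply: wreathP => i; last by rewrite /= mulgV.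
by rewrite !ffunE invgK mulVg.
Qed.

HB.instance Definition _ :=
  Finite_isGroup.Build wreath wreath_mulA wreath_mul1 wreath_mulV.

Lemma wr_funM a b i :
  wr_fun (a * b) i = wr_fun a i * wr_fun b ((wr_perm a)^-1 i).
Proof. by rewrite ffunE. Qed.

Lemma wr_permM a b i : wr_perm (a * b) i = wr_perm a (wr_perm b i).
Proof. by rewrite permM. Qed.

(* the Γ≀Σ_n-set X^n *)
Section Power.
Variable X : gset gT.
Let f a (x : {ffun 'I_n -> X}) : {ffun 'I_n -> X} :=
  [ffun i => lact (wr_fun a i) (x ((wr_perm a)^-1 i))].
Fact power_gset1 x : f 1 x = x.
Proof. by apply/ffunP=> i; rewrite !ffunE invg1 perm1 lact1. Qed.
Fact power_gsetM a b x : f (a * b) x = f a (f b x).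
Proof. by apply/ffunP=> i; rewrite !ffunE lactM invMg permM. Qed.
Definition power_gset : gset wreath := left_gset power_gset1 power_gsetM.
End Power.

(* the left action of Γ≀Σ_n on [n] *)
Section Index.
Let f (a : wreath) (i : 'I_n) := wr_perm a i.
Fact index_gset1 i : f 1 i = i. Proof. exact: perm1. Qed.
Fact index_gsetM a b i : f (a * b) i = f a (f b i). Proof. exact: permM. Qed.
Definition index_gset : gset wreath := left_gset index_gset1 index_gsetM.
End Index.

(* H_ii *)
Definition diag_set (H : {group wreath}) (i : 'I_n) : {set gT} :=
  [set wr_fun a i | a in H & wr_perm a i == i].

Fact diag_group_set H i : group_set (diag_set H i).
Proof.
apply/group_setP; split.
  by apply/imsetP; exists 1; rewrite ?inE ?group1 ?perm1 ?ffunE /=.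
move=> _ _ /imsetP[a + ->] /imsetP[b + ->].
rewrite !inE => /andP[Ha /eqP ai] /andP[Hb /eqP bi].
have ai' : (wr_perm a)^-1 i = i by rewrite -[in LHS]ai permK.
apply/imsetP; exists (a * b); last by rewrite wr_funM ai'.
by rewrite !inE groupM //= permM bi ai.
Qed.

Definition diag_group H i : {group gT} := Group (diag_group_set H i).

End Wreath.

(* The inclusion (Γ≀Σ_i) × (Γ≀Σ_j) -> Γ≀Σ_n for i + j = n, on the first i and
   the last j letters. *)
Section Block.
Variables (gT : finGroupType) (i j n : nat) (e : (i + j)%N = n).

Let inl_ (k : 'I_i) : 'I_n := cast_ord e (lshift j k).
Let inr_ (k : 'I_j) : 'I_n := cast_ord e (rshift i k).
Let split_ (k : 'I_n) : 'I_i + 'I_j := split (cast_ord (esym e) k).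

Definition block_fun (s : 'S_i) (t : 'S_j) (k : 'I_n) : 'I_n :=
  match split_ k with inl k' => inl_ (s k') | inr k' => inr_ (t k') end.

Let split_inl k : split_ (inl_ k) = inl k.
Proof. by rewrite /split_ cast_ordK; apply: (unsplitK (inl k)). Qed.
Let split_inr k : split_ (inr_ k) = inr k.
Proof. by rewrite /split_ cast_ordK; apply: (unsplitK (inr k)). Qed.
Let splitP_ k : match split_ k with inl k' => inl_ k' | inr k' => inr_ k' end = k.
Proof.
rewrite -[RHS](cast_ordKV e) -[in RHS](splitK (cast_ord (esym e) k)).
by rewrite -/(split_ k); case: (split_ k).
Qed.

Lemma block_funM s t s' t' k :
  block_fun s t (block_fun s' t' k) = block_fun (s' * s) (t' * t) k.
Proof.
by rewrite {2 3}/block_fun; case: (split_ k) => k';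
  rewrite /block_fun ?split_inl ?split_inr permM.
Qed.

Lemma block_fun1 k : block_fun 1 1 k = k.
Proof. by rewrite -[RHS]splitP_ /block_fun; case: (split_ k) => ?; rewrite perm1. Qed.

Fact block_fun_inj s t : injective (block_fun s t).
Proof.
apply: (can_inj (g := block_fun s^-1 t^-1)) => k.
by rewrite block_funM !mulgV block_fun1.
Qed.

Definition block_perm s t : 'S_n := perm (@block_fun_inj s t).

Definition wr_block (p : wreath gT i * wreath gT j) : wreath gT n :=
  Wreath [ffun k => match split_ k with
                    | inl k' => wr_fun p.1 k'
                    | inr k' => wr_fun p.2 k'
                    end]
         (block_perm (wr_perm p.1) (wr_perm p.2)).

Fact wr_blockM : {in [set: wreath gT i * wreath gT j] &,
  {morph wr_block : p q / p * q}}.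
Proof.
move=> p q _ _; apply: wreathP => k; last first.
  by rewrite /= !permE /= !permE block_funM.
have -> : wr_fun (wr_block p * wr_block q) k = wr_fun (wr_block p) k *
   wr_fun (wr_block q) (block_fun (wr_perm p.1)^-1 (wr_perm p.2)^-1 k).
  rewrite wr_funM; congr (_ * wr_fun _ _); apply: (canLR (permK _)).
  by rewrite permE block_funM !mulVg block_fun1.
rewrite !ffunE /block_fun; case: (split_ k) => k'.
  by rewrite split_inl ffunE.
by rewrite split_inr ffunE.
Qed.

Canonical wr_block_morphism := Morphism wr_blockM.
End Block.

(** * Transfer product and power operations *)

Section Transfer.
Variables (gT : finGroupType) (i j n : nat) (e : (i + j)%N = n).

(* the Γ≀Σ_n-set (Γ≀Σ_n) ×_{Γ≀Σ_i × Γ≀Σ_j} (X × Y) *)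
Definition transfer_gset (X : gset (wreath gT i)) (Y : gset (wreath gT j)) :
  gset (wreath gT n) :=
  ind_gset (wr_block_morphism gT e) (extprod_gset X Y).

(* Biadditive extension; see [transfer_class] for the value on [X] and [Y]. *)
Definition transfer (x : burnside (wreath gT i)) (y : burnside (wreath gT j)) :
  burnside (wreath gT n) :=
  (\sum_c \sum_d
    gset_class (transfer_gset (coset_gset (conj_repr c))
                              (coset_gset (conj_repr d))) *~ (x c * y d))%R.

End Transfer.

Section TransferTheory.
Variables (gT : finGroupType) (i j n : nat) (e : (i + j)%N = n).

Lemma wr_block_inj : 'injm (wr_block_morphism gT e).
Proof.
apply/injmP=> -[a b] [a' b'] _ _ E.
have Ef k : wr_fun (wr_block e (a, b)) k = wr_fun (wr_block e (a', b')) k.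
  by rewrite [wr_block e _]E.
have Ep k : wr_perm (wr_block e (a, b)) k = wr_perm (wr_block e (a', b')) k.
  by rewrite [wr_block e _]E.
have Kl k : split (cast_ord (esym e) (cast_ord e (lshift j k))) = inl k.
  by rewrite cast_ordK; apply: (unsplitK (inl k)).
have Kr k : split (cast_ord (esym e) (cast_ord e (rshift i k))) = inr k.
  by rewrite cast_ordK; apply: (unsplitK (inr k)).
congr pair; apply: wreathP => k.
- by have := Ef (cast_ord e (lshift j k)); rewrite !ffunE Kl.
- have := Ep (cast_ord e (lshift j k)); rewrite !permE /block_fun Kl.
  by move/cast_ord_inj/lshift_inj.
- by have := Ef (cast_ord e (rshift i k)); rewrite !ffunE Kr.
have := Ep (cast_ord e (rshift i k)); rewrite !permE /block_fun Kr.
by move/cast_ord_inj/rshift_inj.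
Qed.

Lemma transfer_class (X : gset (wreath gT i)) (Y : gset (wreath gT j)) :
  transfer e (gset_class X) (gset_class Y) = gset_class (transfer_gset e X Y).
Proof.
rewrite [RHS](gset_class_ind wr_block_inj) gset_class_extprod.
under [RHS]eq_bigr do rewrite sum_ffunE mulrz_sumr.
rewrite exchange_big; apply: eq_bigr => c _.
under [RHS]eq_bigr do rewrite sum_ffunE mulrz_sumr.
rewrite exchange_big; apply: eq_bigr => d _.
rewrite (gset_class_ind wr_block_inj) mulrz_suml; apply: eq_bigr => b _.
by rewrite [in RHS]burnsideMz [RHS]mulrzA.
Qed.
End TransferTheory.

Section Graded.
Variable gT : finGroupType.

(* The full product over n of the A(Γ≀Σ_n), used to form iterated ⋆-products
   without transporting along equalities of degrees. *)
Definition graded := forall n, burnside (wreath gT n).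

Definition homog k (x : burnside (wreath gT k)) : graded := fun n =>
  match k =P n with
  | ReflectT e => ecast m (burnside (wreath gT m)) e x
  | ReflectF _ => 0%R
  end.

Definition star (x y : graded) : graded := fun n =>
  (\sum_(i < n.+1) transfer (subnKC (leq_ord i)) (x i) (y (n - i)%N))%R.

Record total_power_operations (P : forall n, burnside gT -> burnside (wreath gT n))
    : Prop := TotalPowerOperations {
  power_class : forall n (X : gset gT),
    P n (gset_class X) = gset_class (power_gset n X);
  power0 : forall x, P 0 x = 1%R;
  powerD : forall n x y,
    P n (x + y)%R = star (fun k => P k x) (fun k => P k y) n
}.

Variable P : forall n, burnside gT -> burnside (wreath gT n).

Definition in_span (hT : finGroupType) (S : {set conj_sort hT}) (x : burnside hT) :=
  forall c, x c != 0%R -> c \in S.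

Definition power_basis n (S : {set conj_sort (wreath gT n)}) : Prop :=
  (forall x, in_span S (P n x)) /\
  (forall T : {set conj_sort (wreath gT n)},
     (forall x, in_span T (P n x)) -> S \subset T).

(* Å(Γ,n), as a subset of A(Γ≀Σ_n) *)
Definition ringA n (y : burnside (wreath gT n)) : Prop :=
  exists2 S, power_basis S & in_span S y.

(* In the ⋆-product over H\[n], the representative of an orbit is its least
   element. *)
Definition r_coset n (H : {group wreath gT n}) : burnside (wreath gT n) :=
  let orb i := orbit (gset_act (index_gset gT n)) H i in
  (\big[star / homog (1%R : burnside (wreath gT 0))]_(
       i < n | [forall j in orb i, (i <= j)%N])
     homog (P #|orb i| (gset_class (coset_gset (diag_group H i))))) n.

Definition r_map n (x : burnside (wreath gT n)) : burnside (wreath gT n) :=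
  (\sum_c r_coset (conj_repr c) *~ x c)%R.

End Graded.

(** * Frobenius–Wielandt maps *)

Definition frobenius_wielandt (C G : finGroupType)
    (w : burnside C -> burnside G) : Prop :=
  forall (x : burnside C) (K : {group G}) (L : {group C}), #|L| = #|K| ->
    marks (w x) (conj_class K) = marks x (conj_class L).

Section RingFrobeniusWielandt.
Variables (C G : finGroupType) (w : burnside C -> burnside G).
Variables (PC : forall n, burnside C -> burnside (wreath C n))
          (PG : forall n, burnside G -> burnside (wreath G n)).

(* The map Å(C) -> Å(G) is given by functions on all of A(C≀Σ_n), of which only
   the values on Å(C,n) matter. *)
Record ring_frobenius_wielandt
    (f : forall n, burnside (wreath C n) -> burnside (wreath G n)) : Prop :=
  RingFrobeniusWielandt {
  rfw_stable : forall n x, ringA PC x -> ringA PG (f n x);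
  rfw_add : forall n x y, @ringA _ PC n x -> ringA PC y ->
    f n (x + y)%R = (f n x + f n y)%R;
  rfw_one : f 0 1%R = 1%R;
  rfw_mul : forall i j x y, @ringA _ PC i x -> @ringA _ PC j y ->
    f (i + j)%N (transfer erefl x y) = transfer erefl (f i x) (f j y);
  rfw_power : forall n x, f n (PC n x) = PG n (w x)
}.

Definition wreath_frobenius_wielandt
    (f : forall n, burnside (wreath C n) -> burnside (wreath G n)) n :
  burnside (wreath C n) -> burnside (wreath G n) :=
  f n \o r_map PC (n := n).

End RingFrobeniusWielandt.

Arguments wreath_frobenius_wielandt {C G} PC f n x.

(* Main.v *)
Require Import Defs.
From mathcomp Require Import all_boot all_order all_algebra all_fingroup all_solvable.

(** The ring map between the Å sends P_n(x) to P_n(w x), so that the square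
    commutes as soon as the projection [r] fixes P_n(x). It does so for every
    finite group Γ and every x in A(Γ), and the notion that shows it is that of
    the stabilizer Stab(x) in Γ≀Σ_n of a tuple x of points of some Γ-set X.

    Every P_n(x) is a combination of classes [(Γ≀Σ_n)/Stab(y)] with y a tuple
    of points ([power_span_power]). This is immediate if x = [X], since the
    orbits of X^n have these stabilizers. It extends to virtual x because the
    span of these classes is stable under the transfer product: the stabilizer
    of the concatenation of two tuples with values in disjoint Γ-sets is the
    product of the two stabilizers ([stab_power_cat]). Hence the x all of whose
    powers lie in the span are stable under sums; they are also stable under
    differences, since P_0 = 1 makes the relation
    P_n(x + y) = sum of the P_i(x) ⋆ P_j(y) solvable for P_n(y) by induction
    on n ([spanned_cancel]).

    The projection [r] fixes [(Γ≀Σ_n)/Stab(x)] ([r_coset_stab]). Two letters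
    are in the same Stab(x)-orbit exactly when their values lie in the same
    Γ-orbit of X, because a transporter of one value to the other can be
    combined with a transposition; and the diagonal group at i is Stab(x_i).
    As (Γ/K)^k is a transitive set with point stabilizer that of a constant
    tuple, [r] sends the class of x to the ⋆-product of the classes of the
    constant tuples (x_i, ..., x_i), one for each block. By [stab_power_cat]
    again, this is the class of their concatenation, which agrees with x up to
    a permutation of the letters and a change of points within Γ-orbits, that
    is, up to the action of Γ≀Σ_n; and this only conjugates the stabilizer. *)

Set Implicit Arguments.
Unset Strict Implicit.
Unset Printing Implicit Defensive.

Import GRing.Theory GroupScope.

(* [transfer] alone is the transfer homomorphism of finite group theory. *)
Local Notation transfer := Defs.transfer.

(** * Transfer products of transitive sets *)

Section Coset.
Variable gT : finGroupType.
Implicit Types (X Y : gset gT) (H K : {group gT}).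

(** The marks homomorphism is injective. *)
Lemma eq_gset_class X Y :
  (forall K, gfix X K = gfix Y K) -> gset_class X = gset_class Y.
Proof.
move=> eqXY; apply/marks_inj/ffunP=> d.
by rewrite -[d]conj_reprK !marks_classE eqXY.
Qed.

Lemma gset_class_transitive X (p : X) :
    (forall q, q \in orbit (gset_act X) setT p) ->
  gset_class X = gset_class (coset_gset 'C[p | gset_act X]).
Proof.
move=> transX; apply: eq_gset_class => K; apply/eqP.
rewrite -(eqn_pmul2r (cardG_gt0 'C[p | gset_act X])) gfix_cosetE -gfix_orbit.
by apply/eqP; congr (_ * _)%N; apply: eq_card => q; rewrite in_setI transX andbT.
Qed.

Lemma gset_class_conj H K : conj_class H = conj_class K ->
  gset_class (coset_gset H) = gset_class (coset_gset K).
Proof. by rewrite !gset_class_coset => ->. Qed.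

Lemma gset_classP X c : gset_class X c != 0%R ->
  exists p : X, c = conj_class 'C[p | gset_act X]%G.
Proof.
rewrite ffunE -lt0n => /card_gt0P[O].
by rewrite inE => /andP[_ /existsP[p /andP[_ /eqP<-]]]; exists p.
Qed.

Lemma burnside_one_coset :
  1%R = gset_class (coset_gset [set: gT]) :> burnside gT.
Proof.
rewrite -[LHS]/(gset_class (point_gset gT)).
rewrite (@gset_class_transitive (point_gset gT) tt) => [|[]]; last first.
  exact: orbit_refl.
apply: gset_class_conj; congr conj_class.
by apply/val_inj/setP=> a; rewrite in_setT; apply/astab1P.
Qed.

Lemma burnside_basis (x : burnside gT) :
  x = (\sum_c gset_class (coset_gset (conj_repr c)) *~ x c)%R.
Proof.
apply/ffunP=> c; rewrite sum_ffunE (bigD1 c) //= big1 => [|d /negPf ne];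
  rewrite burnsideMz gset_class_coset ffunE conj_reprK.
  by rewrite eqxx mul1r addr0.
by rewrite eq_sym ne mul0r.
Qed.

End Coset.

(** Induction in stages, W ×_Γ (Γ/H) = W/H. Both sides are compared by marks:
    fixed points of a group K count pairs (w, u) such that the conjugate of K
    by w lies in the conjugate by f u of the image of H, and substituting
    f u w^-1 for w makes that condition independent of u. *)
Lemma gset_class_ind_coset (hT wT : finGroupType)
    (f : {morphism [set: hT] >-> wT}) (H : {group hT}) : 'injm f ->
  gset_class (ind_gset f (coset_gset H)) = gset_class (coset_gset (f @* H)).
Proof.
move=> injf; apply: eq_gset_class => K; apply/eqP.
rewrite -(eqn_pmul2r (cardG_gt0 H)) -(eqn_pmul2r (cardG_gt0 [set: hT])).
rewrite -[X in (_ == gfix _ _ * X * _)%N](card_injm injf (subsetT H)).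
rewrite gfix_cosetE mulnAC [#|[set: hT]%G|]cardsT gfix_ind // big_distrl /=.
transitivity (\sum_(u : hT) #|[set w | K \subset (f @* H) :^ (f u * w^-1)]| ==
   #|[set g | K \subset (f @* H) :^ g]| * #|hT|)%N.
  congr (_ == _); pose Q u w := K :^ w \subset (f @* H) :^ f u.
  transitivity (\sum_w \sum_(u | Q u w) 1)%N; last first.
    rewrite (exchange_big_dep predT) //=; apply: eq_bigr => u _.
    rewrite sum1_card; apply: eq_card => w.
    by rewrite inE [LHS]unfold_in /Q conjsgM sub_conjg.
  rewrite big_mkcond; apply: eq_bigr => w _.
  case: ifP => [sub|nsub].
    rewrite gfix_cosetE -sum1_card; apply: eq_bigl => u.
    by rewrite inE /Q -morphimJ ?inE // sub_morphpre_injm ?subsetT.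
  rewrite big_pred0 // => u; apply: contraFF nsub => /subset_trans-> //.
  by rewrite -morphimJ ?inE // morphimS ?subsetT.
(* Taking g := f u w^-1 as the new variable removes u from the condition. *)
apply/eqP; rewrite mulnC -sum_nat_const; apply: eq_bigr => u _.
rewrite -[LHS](card_preimset _ (inv_inj (@invgK wT))) -[LHS](card_lcoset _ (f u)).
apply: eq_card => w; rewrite mem_lcoset !inE invgK; congr (_ \subset _ :^ _).
by rewrite mulKVg.
Qed.

Lemma gset_class_extprod_coset (gT1 gT2 : finGroupType)
    (H : {group gT1}) (K : {group gT2}) :
  gset_class (extprod_gset (coset_gset H) (coset_gset K))
  = gset_class (coset_gset (setX_group H K)).
Proof.
apply: eq_gset_class => L; apply/eqP.
rewrite -(eqn_pmul2r (cardG_gt0 (setX_group H K))) gfix_cosetE gfix_extprod.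
rewrite cardsX mulnACA !gfix_cosetE -cardsX; apply/eqP/eq_card => -[g h].
rewrite in_setX !inE; have memE a b :
    ((a, b) \in setX H K :^ (g, h)) = (a \in H :^ g) && (b \in K :^ h).
  by rewrite !mem_conjg; apply: in_setX.
apply/andP/idP => [[/subsetP s1 /subsetP s2]|/subsetP s].
  apply/subsetP=> -[a b] Lab; rewrite memE.
  rewrite s1 ?s2 //; first by apply/morphimP; exists (a, b); rewrite ?inE.
  by apply/morphimP; exists (a, b); rewrite ?inE.
by split; apply/subsetP=> _ /morphimP[[a b] _ /s + ->]; rewrite memE => /andP[].
Qed.

Section Transfer.
Variables (gT : finGroupType) (i j n : nat) (e : (i + j)%N = n).
Implicit Types (H : {group wreath gT i}) (K : {group wreath gT j}).

Lemma transfer_coset H K :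
  transfer e (gset_class (coset_gset H)) (gset_class (coset_gset K))
  = gset_class (coset_gset (wr_block_morphism gT e @* setX_group H K)).
Proof.
rewrite transfer_class -(gset_class_ind_coset _ (wr_block_inj gT e)).
rewrite !(gset_class_ind (wr_block_inj gT e)).
by rewrite gset_class_extprod_coset.
Qed.

(** The transfer product as a combination of classes of transitive sets, on
    which membership in a span can be read off. *)
Lemma transferE x y : transfer e x y = (\sum_c \sum_d
  gset_class (coset_gset (wr_block_morphism gT e @*
     setX_group (conj_repr c) (conj_repr d))) *~ (x c * y d))%R.
Proof. by do 2!apply: eq_bigr => ? _; rewrite -transfer_coset transfer_class. Qed.

Lemma transfer0l y : transfer e 0%R y = 0%R :> burnside (wreath gT n).
Proof.
by rewrite /transfer; do 2!apply: big1 => ? _; rewrite ffunE mul0r.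
Qed.

Lemma transfer0r x : transfer e x 0%R = 0%R :> burnside (wreath gT n).
Proof.
by rewrite /transfer; do 2!apply: big1 => ? _; rewrite ffunE mulr0.
Qed.

End Transfer.

Section TransferOne.
Variables (gT : finGroupType) (m : nat).

(** The group Γ≀Σ_0 is trivial, so that the block inclusion of
    (Γ≀Σ_0) × (Γ≀Σ_m) is the second projection. *)
Lemma transfer1l (e : (0 + m = m)%N) (y : burnside (wreath gT m)) :
  transfer e 1%R y = y.
Proof.
have block1 (a : wreath gT 0) b : wr_block_morphism gT e (a, b) = b.
  have rE (k : 'I_m) : cast_ord (esym e) k = rshift 0 k by apply: val_inj.
  have splitE (k : 'I_m) : split (cast_ord (esym e) k) = inr k.
    by rewrite rE; apply: (unsplitK (inr k)).
  apply: wreathP => k; first by rewrite ffunE splitE.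
  by rewrite permE /block_fun splitE; apply: val_inj.
have oneE c : (1%R : burnside (wreath gT 0)) c
    = ((c == conj_class [set: wreath gT 0])%:Z)%R.
  by rewrite burnside_one_coset gset_class_coset ffunE.
rewrite transferE (bigD1 (conj_class [set: wreath gT 0])) //=.
rewrite [X in (_ + X)%R]big1 ?addr0 => [|c /negPf ne]; last first.
  by apply: big1 => d _; rewrite oneE ne mul0r.
rewrite [RHS]burnside_basis; apply: eq_bigr => d _.
rewrite oneE eqxx mul1r; congr (_ *~ _)%R.
apply: gset_class_conj; congr conj_class.
apply: val_inj; apply/setP=> b /=; apply/morphimP/idP => [[[a b'] _]|Hb].
  by rewrite in_setX => /andP[_ /= Hb] ->; rewrite block1.
by exists (1, b); rewrite ?in_setX ?inE ?group1 ?block1.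
Qed.
End TransferOne.

(** * Stabilizers of tuples of points *)

Section Stabilizer.
Variable gT : finGroupType.
Implicit Types X Y : gset gT.

(** Bundled as a group, to be compared with [diag_group] and [conj_repr]. *)
Definition stab X (p : X) : {group gT} := 'C[p | gset_act X]%G.

Lemma stabP X (p : X) g : reflect (lact g p = p) (g \in stab p).
Proof. by rewrite -groupV; apply: astab1P. Qed.

Lemma lactK X g : cancel (@lact gT X g) (lact g^-1).
Proof. by move=> p; rewrite -lactM mulVg lact1. Qed.

Lemma orbitTP X (p q : X) :
  reflect (exists g, lact g p = q) (q \in orbit (gset_act X) setT p).
Proof.
apply: (iffP orbitP) => [[g _ <-]|[g <-]]; exists g^-1; rewrite ?inE //.
by rewrite /lact invgK.
Qed.

Lemma stab_lact X g (p : X) : conj_class (stab (lact g p)) = conj_class (stab p).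
Proof. by apply/eqP/conj_classP; exists g^-1; apply: astab1_act. Qed.

Lemma stab_lactP X (p : X) (H : {group gT}) :
  conj_class H = conj_class (stab p) -> exists q : X, H = stab q.
Proof.
move/eqP/conj_classP=> [g E]; exists (gset_act X p g).
by apply/val_inj; rewrite /= E; apply/esym/astab1_act.
Qed.

End Stabilizer.

Section PowerStabilizer.
Variables (gT : finGroupType) (n : nat).
Implicit Types X Y : gset gT.

Lemma power_lactE X (a : wreath gT n) (x : power_gset n X) i :
  (lact a x : {ffun _ -> _}) i
  = lact (wr_fun a i) ((x : {ffun _ -> _}) ((wr_perm a)^-1 i)).
Proof. by rewrite /power_gset left_gsetE ffunE. Qed.

(** The condition is indexed by the source i of the letter rather than by its
    target, which avoids inverse permutations. *)
Lemma power_stabP X (x : {ffun 'I_n -> X}) (a : wreath gT n) :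
  reflect (forall i, lact (wr_fun a (wr_perm a i)) (x i) = x (wr_perm a i))
          (a \in stab (x : power_gset n X)).
Proof.
apply: (iffP (stabP _ _)) => [E i|E].
  by rewrite -[in RHS]E power_lactE permK.
apply/ffunP=> i; rewrite power_lactE.
by have := E ((wr_perm a)^-1 i); rewrite permKV.
Qed.

(** The stabilizer of a tuple only sees the transporters between its entries,
    so that the ambient set can be changed. *)
Lemma eq_power_stab X Y (x : {ffun 'I_n -> X}) (y : {ffun 'I_n -> Y}) :
    (forall i j g, lact g (x i) = x j <-> lact g (y i) = y j) ->
  stab (x : power_gset n X) = stab (y : power_gset n Y).
Proof.
move=> exy; apply/val_inj/setP=> a.
by apply/power_stabP/power_stabP=> E i; apply/exy.
Qed.

End PowerStabilizer.

Section Concatenation.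
Variables (gT : finGroupType) (X : gset gT) (i j n : nat) (e : (i + j)%N = n).
Variables (x : {ffun 'I_i -> X}) (y : {ffun 'I_j -> X}).

Local Notation inL k := (cast_ord e (lshift j k)).
Local Notation inR k := (cast_ord e (rshift i k)).

Lemma split_inL k : split (cast_ord (esym e) (inL k)) = inl k.
Proof. by rewrite cast_ordK; apply: (unsplitK (inl k)). Qed.

Lemma split_inR k : split (cast_ord (esym e) (inR k)) = inr k.
Proof. by rewrite cast_ordK; apply: (unsplitK (inr k)). Qed.

Lemma block_ind (P : 'I_n -> Prop) :
  (forall k, P (inL k)) -> (forall k, P (inR k)) -> forall k, P k.
Proof.
move=> PL PR k; rewrite -(cast_ordKV e k) -(splitK (cast_ord (esym e) k)).
by case: (split _) => k'; [apply: PL | apply: PR].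
Qed.

Definition power_cat : {ffun 'I_n -> X} := [ffun k =>
  match split (cast_ord (esym e) k) with inl k' => x k' | inr k' => y k' end].

Lemma power_catL k : power_cat (inL k) = x k.
Proof. by rewrite ffunE split_inL. Qed.

Lemma power_catR k : power_cat (inR k) = y k.
Proof. by rewrite ffunE split_inR. Qed.

Lemma wr_block_funL (p : wreath gT i * wreath gT j) k :
  wr_fun (wr_block e p) (inL k) = wr_fun p.1 k.
Proof. by rewrite ffunE split_inL. Qed.

Lemma wr_block_funR (p : wreath gT i * wreath gT j) k :
  wr_fun (wr_block e p) (inR k) = wr_fun p.2 k.
Proof. by rewrite ffunE split_inR. Qed.

Lemma wr_block_permL (p : wreath gT i * wreath gT j) k :
  wr_perm (wr_block e p) (inL k) = inL (wr_perm p.1 k).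
Proof. by rewrite permE /block_fun split_inL. Qed.

Lemma wr_block_permR (p : wreath gT i * wreath gT j) k :
  wr_perm (wr_block e p) (inR k) = inR (wr_perm p.2 k).
Proof. by rewrite permE /block_fun split_inR. Qed.

Hypothesis disj : forall k l g, lact g (x k) <> y l.

(** A stabilizing element permutes the letters within each Γ-orbit of values,
    hence cannot mix the letters of x with those of y: it splits as a pair. *)
Lemma stab_power_cat :
  (wr_block_morphism gT e @*
     setX_group (stab (x : power_gset i X)) (stab (y : power_gset j X)))%G
  = stab (power_cat : power_gset n X).
Proof.
apply/val_inj/setP=> a; apply/morphimP/idP => [[[b c] _ + ->]|/power_stabP fixa].
  rewrite in_setX => /andP[/= /power_stabP fx /power_stabP fy].
  apply/power_stabP; apply: block_ind => k; rewrite [wr_block_morphism _ _ _]/=.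
    by rewrite wr_block_permL wr_block_funL !power_catL.
  by rewrite wr_block_permR wr_block_funR !power_catR.
have /fin_all_exists[s sE] k : exists k', wr_perm a (inL k) = inL k'.
  have := fixa (inL k); rewrite power_catL.
  elim/block_ind: (wr_perm a _) => k'; first by exists k'.
  by rewrite power_catR => /disj.
have /fin_all_exists[t tE] k : exists k', wr_perm a (inR k) = inR k'.
  have := fixa (inR k); rewrite power_catR.
  elim/block_ind: (wr_perm a _) => k'; last by exists k'.
  by rewrite power_catL => /(canRL (lactK _))/esym/disj.
(* Restricted to each block, a is a wreath product element. *)
have s_inj : injective s.
  move=> k l E; apply/(@lshift_inj _ j)/(@cast_ord_inj _ _ e).
  by apply: (@perm_inj _ (wr_perm a)); rewrite !sE E.
have t_inj : injective t.
  move=> k l E; apply/(@rshift_inj i)/(@cast_ord_inj _ _ e).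
  by apply: (@perm_inj _ (wr_perm a)); rewrite !tE E.
pose b := Wreath [ffun k => wr_fun a (inL k)] (perm s_inj).
pose c := Wreath [ffun k => wr_fun a (inR k)] (perm t_inj).
exists (b, c); first exact: in_setT; last first.
  apply: wreathP; apply: block_ind => k; rewrite [wr_block_morphism _ _ _]/=.
  - by rewrite wr_block_funL ffunE.
  - by rewrite wr_block_funR ffunE.
  - by rewrite wr_block_permL permE.
  by rewrite wr_block_permR permE.
rewrite in_setX; apply/andP; split; apply/power_stabP=> k; rewrite permE ffunE.
  by have := fixa (inL k); rewrite sE !power_catL.
by have := fixa (inR k); rewrite tE !power_catR.
Qed.

End Concatenation.

Section Sum.
Variables (gT : finGroupType) (X Y : gset gT).

Definition sum_lact (g : gT) (p : X + Y) : X + Y :=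
  match p with inl q => inl (lact g q) | inr q => inr (lact g q) end.

Fact sum_lact1 p : sum_lact 1 p = p.
Proof. by case: p => q; rewrite /= lact1. Qed.

Fact sum_lactM g h p : sum_lact (g * h) p = sum_lact g (sum_lact h p).
Proof. by case: p => q; rewrite /= lactM. Qed.

Definition sum_gset : gset gT := left_gset sum_lact1 sum_lactM.

Lemma sum_lactE g (p : sum_gset) : lact g p = sum_lact g p.
Proof. exact: left_gsetE. Qed.

End Sum.

Section PowerSpan.
Variable gT : finGroupType.

(** The conjugacy classes of the stabilizers of points of powers X^n; the
    corresponding basis elements span Å(Γ,n). *)
Definition power_like n (c : conj_sort (wreath gT n)) : Prop :=
  exists (X : gset gT) (x : power_gset n X), c = conj_class (stab x).

Definition power_span n (u : burnside (wreath gT n)) : Prop :=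
  forall c, u c != 0%R -> power_like c.

Lemma power_span_class n (X : gset gT) : power_span (gset_class (power_gset n X)).
Proof. by move=> c /gset_classP[x ->]; exists X, x. Qed.

Lemma power_span0 n : @power_span n 0%R.
Proof. by move=> c; rewrite ffunE eqxx. Qed.

Lemma power_spanD n (u v : burnside (wreath gT n)) :
  power_span u -> power_span v -> power_span (u + v)%R.
Proof.
move=> Su Sv c; rewrite ffunE; have [->|/Su //] := eqVneq (u c) 0%R.
by rewrite add0r => /Sv.
Qed.

Lemma power_spanN n (u : burnside (wreath gT n)) :
  power_span u -> power_span (- u)%R.
Proof. by move=> Su c; rewrite ffunE oppr_eq0; apply: Su. Qed.

Lemma power_span_sum n (I : Type) (r : seq I) (P : pred I)
    (F : I -> burnside (wreath gT n)) :
  (forall i, P i -> power_span (F i)) -> power_span (\sum_(i <- r | P i) F i)%R.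
Proof.
move=> SF; apply: (big_ind (@power_span n)) => // [|u v].
  exact: power_span0.
exact: power_spanD.
Qed.

(** In the disjoint union of X and Y no entry of the first tuple can be moved
    to an entry of the second, so that their stabilizers multiply. *)
Lemma power_like_block i j n (e : (i + j)%N = n) c d :
    @power_like i c -> @power_like j d ->
  power_like (conj_class
    (wr_block_morphism gT e @* setX_group (conj_repr c) (conj_repr d))).
Proof.
move=> [X [x0 cE]] [Y [y0 dE]].
have [x ->] : exists x : power_gset i X, conj_repr c = stab x.
  by apply: (@stab_lactP _ _ x0); rewrite conj_reprK.
have [y ->] : exists y : power_gset j Y, conj_repr d = stab y.
  by apply: (@stab_lactP _ _ y0); rewrite conj_reprK.
pose Z := sum_gset X Y.
pose x' : {ffun 'I_i -> Z} := [ffun k => inl ((x : {ffun _ -> _}) k)].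
pose y' : {ffun 'I_j -> Z} := [ffun k => inr ((y : {ffun _ -> _}) k)].
have -> : stab x = stab (x' : power_gset i Z).
  by apply: eq_power_stab => k l g; rewrite !ffunE sum_lactE; split=> [/= ->|[]].
have -> : stab y = stab (y' : power_gset j Z).
  by apply: eq_power_stab => k l g; rewrite !ffunE sum_lactE; split=> [/= ->|[]].
exists Z, (power_cat e x' y'); congr conj_class.
by apply: stab_power_cat => k l g; rewrite !ffunE sum_lactE.
Qed.

Lemma power_span_transfer i j n (e : (i + j)%N = n) u v :
  @power_span i u -> @power_span j v -> power_span (transfer e u v).
Proof.
move=> Su Sv; rewrite transferE; apply: power_span_sum => c _.
apply: power_span_sum => d _ b.
rewrite burnsideMz gset_class_coset ffunE 2!mulf_eq0 !negb_or.
case/and3P; case: (b =P _) => [-> _ /Su Pc /Sv Pd|//].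
exact: power_like_block.
Qed.

End PowerSpan.

Section TotalPower.
Variable gT : finGroupType.
Variable P : forall n, burnside gT -> burnside (wreath gT n).
Hypothesis P_power : total_power_operations P.

Let spanned x := forall n, power_span (P n x).

Lemma spannedD x y : spanned x -> spanned y -> spanned (x + y)%R.
Proof.
move=> Sx Sy n; rewrite (powerD P_power); apply: power_span_sum => i _.
exact: power_span_transfer.
Qed.

(** The term i = 0 of P_n(x + y) is P_0(x) ⋆ P_n(y) = P_n(y), while all the
    other terms involve P_m(y) with m < n only. *)
Lemma spanned_cancel x y : spanned x -> spanned (x + y)%R -> spanned y.
Proof.
move=> Sx Sxy n; elim/ltn_ind: n => n IHn.
have := Sxy n; rewrite (powerD P_power) /star big_ord_recl /= => Sn.
set s := (\sum_(i < n) _)%R in Sn.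
have Ss : power_span s.
  apply: power_span_sum => i _; apply: power_span_transfer => //.
  by apply: IHn; rewrite /= /bump /= add1n ltn_subrL /= (leq_trans _ (ltn_ord i)).
have := power_spanD Sn (power_spanN Ss).
rewrite addrK (power0 P_power).
have: (n - 0 = n)%N := subn0 n.
(* The degree n - 0 only equals n propositionally. *)
move: (subnKC _); rewrite /=; move: (n - 0)%N => m e mn; subst m.
by rewrite transfer1l.
Qed.

(** Classes of sets generate A(Γ) as a group, so that stability under sums and
    cancellation is enough. *)
Lemma power_span_power n x : power_span (P n x).
Proof.
have Sclass (X : gset gT) : spanned (gset_class X).
  by move=> m; rewrite (power_class P_power); apply: power_span_class.
have S0 : spanned 0%R.
  by apply: (@spanned_cancel (gset_class (point_gset gT))); rewrite ?addr0.
have SN y : spanned y -> spanned (- y)%R.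
  by move=> Sy; apply: (spanned_cancel Sy); rewrite subrr.
move: n; rewrite -/(spanned x) [x]burnside_basis.
apply: (big_ind spanned) => //; first exact: spannedD.
move=> c _; have Sn m : spanned (gset_class (coset_gset (conj_repr c)) *+ m)%R.
  by elim: m => [|m IHm]; rewrite ?mulr0n // mulrS; apply: spannedD.
by case: (x c) => m; rewrite ?NegzE ?mulrNz -pmulrn //; apply: SN.
Qed.

End TotalPower.

(** * The projection on classes of stabilizers *)

Section Homogeneous.
Variable gT : finGroupType.

Lemma homogE k (u : burnside (wreath gT k)) : homog u k = u.
Proof. by rewrite /homog; case: eqP => // e; rewrite eq_axiomK. Qed.

Lemma homog_neq k n (u : burnside (wreath gT k)) : k != n -> homog u n = 0%R.
Proof. by rewrite /homog; case: eqP. Qed.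

Lemma eq_star (u u' v v' : graded gT) :
  (forall m, u m = u' m) -> (forall m, v m = v' m) ->
  forall n, star u v n = star u' v' n.
Proof. by move=> eu ev n; apply: eq_bigr => i _; rewrite eu ev. Qed.

(** Only the summand of bidegree (i, j) survives. *)
Lemma star_homog i j (u : burnside (wreath gT i)) (v : burnside (wreath gT j)) n :
  star (homog u) (homog v) n = homog (transfer erefl u v) n.
Proof.
have [ijn | ijn] := eqVneq (i + j)%N n.
  subst n; rewrite homogE /star.
  have lt_i : (i < (i + j).+1)%N by rewrite ltnS leq_addr.
  rewrite (bigD1 (Ordinal lt_i)) //= big1 => [|k ki]; last first.
    rewrite homog_neq ?transfer0l //; apply: contraNneq ki => ik.
    exact/eqP/val_inj.
  rewrite addr0; move: (subnKC _); rewrite /=; move: (_ - _)%N => m e.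
  have mj := addnI e; subst m.
  by rewrite !homogE (eq_axiomK e).
rewrite homog_neq // /star big1 // => k _.
have [ik | ik] := eqVneq i k; last by rewrite (homog_neq _ ik) transfer0l.
rewrite [homog v _]homog_neq ?transfer0r //.
by apply: contraNneq ijn => ->; rewrite ik subnKC // leq_ord.
Qed.

End Homogeneous.

Section PointClass.
Variables (gT : finGroupType) (X : gset gT).
Implicit Types (s t : seq X) (p : X).

Local Notation orb p := (orbit (gset_act X) setT p).

(** The basis element of the orbit of x in X^n. *)
Definition point_class n (x : {ffun 'I_n -> X}) : burnside (wreath gT n) :=
  gset_class (coset_gset (stab (x : power_gset n X))).

(** A permutation s and elements of Γ that carry y_(s i) to x_i assemble into
    an element of Γ≀Σ_n that carries y to x. *)
Lemma point_class_orbits n (x y : {ffun 'I_n -> X}) (s : 'S_n) :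
  (forall i, x i \in orb (y (s i))) -> point_class x = point_class y.
Proof.
move=> xy; have /fin_all_exists[g gE] i : exists g, lact g (y (s i)) = x i.
  exact/orbitTP.
have -> : x = lact (Wreath [ffun i => g i] s^-1) (y : power_gset n X).
  by apply/ffunP=> i; rewrite power_lactE ffunE /= invgK gE.
exact/gset_class_conj/stab_lact.
Qed.

(** Tuples of arbitrary length, in the graded ring: concatenations then need
    no transport along equalities of degrees. *)
Definition seq_class s : graded gT :=
  homog (point_class [ffun i => tnth (in_tuple s) i]).

Lemma seq_class_tuple n (t : n.-tuple X) m :
  seq_class t m = homog (point_class [ffun i => tnth t i]) m.
Proof.
case: t => s /= s_n; have e := eqP s_n; subst n; rewrite /seq_class.
suff -> : in_tuple s = Tuple s_n by [].
exact: val_inj.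
Qed.

(** The class of a tuple only depends on the multiset of the Γ-orbits of its
    entries. *)
Lemma seq_class_perm s t : perm_eq [seq orb p | p <- s] [seq orb p | p <- t] ->
  forall m, seq_class s m = seq_class t m.
Proof.
move=> st m; have /esym/eqP e := perm_size st; rewrite !size_map in e.
rewrite (seq_class_tuple (Tuple e)) /seq_class; congr (homog _ m).
have /tuple_permP[u uE] : perm_eq [seq orb p | p <- s]
    (map_tuple (fun p => orb p) (Tuple e)) by [].
apply: (point_class_orbits (s := u)) => i; rewrite !ffunE; apply/orbit_eqP.
have := congr1 (fun r => nth set0 r i) uE.
rewrite (nth_map (tnth (in_tuple s) i)) //.
rewrite -(tnth_nth _ (in_tuple s)).
by rewrite -(tnth_nth _ [tuple _ | _ < _]) tnth_mktuple tnth_map.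
Qed.

Lemma seq_class_cat s t : (forall p q, p \in s -> q \in t -> q \notin orb p) ->
  forall m, seq_class (s ++ t) m = star (seq_class s) (seq_class t) m.
Proof.
move=> disj m; rewrite star_homog.
rewrite (seq_class_tuple (cat_tuple (in_tuple s) (in_tuple t))).
congr (homog _ m); rewrite transfer_coset stab_power_cat => [|k l g E].
  congr point_class; apply/ffunP; apply: (@block_ind _ _ _ (erefl _)) => k.
    rewrite power_catL !ffunE -[RHS](tnth_lshift _ (in_tuple t)).
    by congr tnth; apply: val_inj.
  rewrite power_catR !ffunE -[RHS](tnth_rshift (in_tuple s)).
  by congr tnth; apply: val_inj.
have /negP[] := disj _ _ (mem_tnth k (in_tuple s)) (mem_tnth l (in_tuple t)).
by apply/orbitTP; exists g; move: E; rewrite !ffunE.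
Qed.

Lemma point_class0 (x : {ffun 'I_0 -> X}) : point_class x = 1%R.
Proof.
rewrite burnside_one_coset; apply: gset_class_conj; congr conj_class.
by apply/val_inj/setP=> a; rewrite in_setT; apply/power_stabP=> -[].
Qed.

Lemma seq_class_nil m :
  seq_class [::] m = homog (1%R : burnside (wreath gT 0)) m.
Proof. by rewrite /seq_class point_class0. Qed.

(** The power (Γ/H)^k is transitive, and for H = Stab(p) the constant tuples
    at H and at p have the same stabilizer. *)
Lemma power_coset_class k p :
  gset_class (power_gset k (coset_gset (stab p))) = point_class [ffun=> p].
Proof.
set H := stab p.
have o_proof : (H : {set gT}) \in lcosets H [set: gT].
  by apply/lcosetsP; exists 1; rewrite ?inE ?lcoset1.
pose o : coset_gset H := exist _ (H : {set gT}) o_proof.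
have stab_o : stab o = H.
  apply/val_inj/setP=> g; apply/stabP/idP => [/(congr1 val)|Hg].
    by rewrite left_gsetE /= => <-; apply: lcoset_refl.
  by apply: val_inj; rewrite left_gsetE /= lcoset_id.
rewrite (@gset_class_transitive _ (power_gset k _) [ffun=> o]) => [|x];
  last first.
  have /fin_all_exists[g gE] i : exists g, lact g o = (x : {ffun _ -> _}) i.
    case/lcosetsP: (valP ((x : {ffun _ -> _}) i)) => g _ xE.
    by exists g; apply: val_inj; rewrite left_gsetE.
  apply/orbitTP; exists (Wreath [ffun i => g i] 1).
  by apply/ffunP=> i; rewrite power_lactE !ffunE.
congr gset_class; congr coset_gset.
apply: eq_power_stab => i j g; rewrite !ffunE.
by split=> /stabP g_st; apply/stabP; [rewrite -/H -stab_o | rewrite stab_o].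
Qed.

End PointClass.

(** In this section, the orbits of Stab(x) on the letters are called blocks. *)
Section RCoset.
Variable gT : finGroupType.
Variable P : forall n, burnside gT -> burnside (wreath gT n).
Hypothesis P_power : total_power_operations P.
Variables (X : gset gT) (n : nat) (x : {ffun 'I_n -> X}).

Local Notation Hx := (stab (x : power_gset n X)).
Local Notation orb p := (orbit (gset_act X) setT p).
Local Notation blk i := (orbit (gset_act (index_gset gT n)) Hx i).

(** If g carries x_i to x_j, the transposition of i and j, decorated by g at j
    and by its inverse at i, stabilizes x. *)
Lemma mem_block i j : (j \in blk i) = (x j \in orb (x i)).
Proof.
apply/orbitP/orbitTP => [[a Ha <-]|[g xij]].
  exists (wr_fun a^-1 (wr_perm a^-1 i)).
  by apply/power_stabP; rewrite groupV.
have [ij|ij] := eqVneq i j; first by exists 1; rewrite ?act1.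
pose a := Wreath [ffun k => if k == j then g else if k == i then g^-1 else 1]
   (tperm i j).
(* Inverted because the right action of the index set encodes a left one. *)
exists a^-1; last by rewrite -[LHS]/(wr_perm a^-1^-1 i) invgK tpermL.
rewrite groupV; apply/power_stabP=> k; rewrite [wr_perm a]/= ffunE.
case: tpermP => [->|->|/eqP/negPf-> /eqP/negPf->]; last exact: lact1.
  by rewrite eqxx.
by rewrite (negPf ij) eqxx -xij lactK.
Qed.

Lemma block_eq i j : (orb (x i) == orb (x j)) = (i \in blk j).
Proof. by rewrite mem_block; apply/eqP/orbit_eqP. Qed.

(** An element of Stab(x_i) placed at i, with 1 elsewhere, stabilizes x. *)
Lemma diag_group_stab i : diag_group Hx i = stab (x i).
Proof.
apply/val_inj/setP=> g; apply/imsetP/stabP => [[a + ->]|gx].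
  by rewrite inE => /andP[/power_stabP/(_ i) + /eqP ai]; rewrite ai.
exists (Wreath [ffun k => if k == i then g else 1] 1); last by rewrite ffunE eqxx.
rewrite inE perm1 eqxx andbT; apply/power_stabP=> k; rewrite perm1 ffunE.
by case: eqP => [->|_]; rewrite ?lact1.
Qed.

Local Notation minimal i := [forall j in blk i, (i <= j)%N].

Lemma minimal_uniq i j : minimal i -> minimal j -> i \in blk j -> i = j.
Proof.
move=> /forall_inP mi /forall_inP mj ij; apply/val_inj/eqP.
by rewrite eqn_leq mi ?mj // orbit_sym.
Qed.

Lemma minimal_exists i : exists2 j, minimal j & j \in blk i.
Proof.
have ii := orbit_refl (gset_act (index_gset gT n)) Hx i.
have [j ji minj] := arg_minnP (@nat_of_ord n) ii.
exists j => //; apply/forall_inP=> k kj; apply: minj.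
exact: orbit_trans kj ji.
Qed.

(** Distinct minimal letters lie in distinct blocks, so that their values lie
    in distinct Γ-orbits and [seq_class_cat] applies at each step. *)
Lemma star_blocks (r : seq 'I_n) : uniq r -> {in r, forall i, minimal i} ->
  forall m, (\big[@star gT/homog (1%R : burnside (wreath gT 0))]_(i <- r)
     homog (P #|blk i| (gset_class (coset_gset (diag_group Hx i))))) m
   = seq_class (flatten [seq nseq #|blk i| (x i) | i <- r]) m.
Proof.
elim: r => [|i r IHr] /= => [_ _|/andP[ri r_uniq] minr] m.
  by rewrite big_nil seq_class_nil.
have [mini {}minr] : minimal i /\ {in r, forall i, minimal i}.
  by split=> [|j rj]; apply: minr; rewrite !inE ?eqxx ?rj ?orbT.
rewrite big_cons seq_class_cat => [|p q /nseqP[-> _]]; last first.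
  case/flatten_mapP=> j rj /nseqP[-> _]; rewrite -mem_block.
  by apply: contraNN ri => ji; rewrite -(minimal_uniq (minr j rj) mini ji).
apply: eq_star => {}m; last exact: IHr.
rewrite diag_group_stab (power_class P_power) power_coset_class.
rewrite (seq_class_tuple (nseq_tuple _ _)); congr (homog (point_class _) m).
by apply/ffunP=> k; rewrite !ffunE tnth_nseq.
Qed.

(** Replacing each x_j by the value at the least letter of its block stays
    within its Γ-orbit, so that both tuples have the same multiset of orbits:
    each orbit occurs as often as the size of the block it comes from. *)
Lemma r_coset_stab : r_coset P Hx = point_class x.
Proof.
rewrite /r_coset -big_filter star_blocks; first last.
- by move=> i; rewrite mem_filter => /andP[].
- by rewrite filter_uniq // index_enum_uniq.
set r := [seq i <- _ | _].
have <- : seq_class [tuple x i | i < n] n = point_class x.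
  rewrite seq_class_tuple homogE; congr point_class.
  by apply/ffunP=> i; rewrite ffunE tnth_mktuple.
apply: seq_class_perm; set s := (X in perm_eq _ X).
have sE : s = [seq orb (x i) | i <- enum 'I_n] by rewrite /s /= -map_comp.
have -> : [seq orb p | p <- flatten [seq nseq #|blk i| (x i) | i <- r]]
    = flatten [seq nseq (count_mem Y s) Y | Y <- [seq orb (x i) | i <- r]].
  rewrite map_flatten -!map_comp; congr flatten; apply: eq_map => i /=.
  rewrite map_nseq sE count_map; congr nseq.
  rewrite enumT -size_filter -/(enum_mem _) -cardE; apply: eq_card => j.
  by rewrite -block_eq.
apply: perm_trans (perm_count_undup s); apply/perm_flatten/perm_map/uniq_perm.
- rewrite map_inj_in_uniq ?filter_uniq ?index_enum_uniq // => i j.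
  rewrite !mem_filter => /andP[mi _] /andP[mj _] /eqP.
  by rewrite block_eq; apply: minimal_uniq.
- exact: undup_uniq.
move=> Y; rewrite mem_undup sE; apply/mapP/mapP => -[i ri ->].
  by exists i; rewrite ?mem_enum.
have [j minj ji] := minimal_exists i; exists j.
  by rewrite mem_filter minj mem_index_enum.
by apply/esym/eqP; rewrite block_eq.
Qed.

End RCoset.

(** On each basis element of the span, the representative chosen in its
    conjugacy class is itself the stabilizer of a tuple. *)
Lemma r_map_power_span (gT : finGroupType)
    (P : forall n, burnside gT -> burnside (wreath gT n)) n u :
  total_power_operations P -> @power_span gT n u -> r_map P u = u.
Proof.
move=> P_power Su; rewrite [RHS]burnside_basis; apply: eq_bigr => c _.
have [->|/Su[X [x cE]]] := eqVneq (u c) 0%R; first by rewrite !mulr0z.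
have [y ->] : exists y : power_gset n X, conj_repr c = stab y.
  by apply: (@stab_lactP _ _ x); rewrite conj_reprK.
by rewrite r_coset_stab.
Qed.

Theorem corollary18p2 (G C : finGroupType)
  (cyclicC : cyclic [set: C]) (cardC : #|[set: C]| = #|[set: G]|)
  (w : {rmorphism burnside C -> burnside G}) (w_fw : frobenius_wielandt w)
  (PC : forall n, burnside C -> burnside (wreath C n))
  (PC_power : total_power_operations PC)
  (PG : forall n, burnside G -> burnside (wreath G n))
  (PG_power : total_power_operations PG)
  (wr : forall n, burnside (wreath C n) -> burnside (wreath G n))
  (wr_rfw : ring_frobenius_wielandt w PC PG wr)
  (n : nat) (x : burnside C) :
  PG n (w x) = wreath_frobenius_wielandt PC wr n (PC n x).
Proof.
rewrite /wreath_frobenius_wielandt /= r_map_power_span ?(rfw_power wr_rfw) //.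
exact: power_span_power.
Qed.
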